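(* For every $\varepsilon>0$ there exist $C_\varepsilon,D_\varepsilon>0$ such that for all $n\in\mathbb{N}$, $$\frac{\#\{f\in\mathbb{F}_2[x]:\deg(f)=n,\ (2-\varepsilon)n\le\tau(f)\le(2+\varepsilon)n\}}{2^n}\ge 1-C_\varepsilon e^{-D_\varepsilon\sqrt{n}}.$$
   Context: Define $T:\mathbb{F}_2[x]\to\mathbb{F}_2[x]$ by $T(f)=\frac{f}{x+1}$ if $f(1)=0$ and $T(f)=\frac{xf+1}{x+1}$ if $f(1)=1$. For nonzero $f$, $\tau(f)$ is the least $k\in\mathbb{N}$ with $T^k(f)=1$ (this is finite). *)

(* Defs.v *)
From HB Require Import structures.
From mathcomp Require Import all_boot all_order all_algebra qpoly.
From mathcomp Require Import boolp reals sequences exp.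
Set Implicit Arguments. Unset Strict Implicit. Unset Printing Implicit Defensive.
Import Order.TTheory GRing.Theory Num.Theory.
Local Open Scope ring_scope.

Definition T (f : {poly 'F_2}) : {poly 'F_2} :=
  if f.[1] == 0 then f %/ ('X + 1) else ('X * f + 1) %/ ('X + 1).

(* tau f = least k with T^k f = 1 (classically chosen; 0 if no such k,
   which by the paper never happens for nonzero f). *)
Definition tau (f : {poly 'F_2}) : nat :=
  match pselect (exists k, iter k T f == 1) with
  | left H => ex_minn H
  | right _ => 0%N
  end.

Definition count_good (R : realType) (eps : R) (n : nat) : nat :=
  #|[set p : {poly_n.+1 'F_2} | (size (val p) == n.+1)%N &&
      ((2 - eps) * n%:R <= (tau (val p))%:R <= (2 + eps) * n%:R)]|.

(* Main.v *)
Require Import Defs.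
From HB Require Import structures.
From mathcomp Require Import all_boot all_order all_algebra qpoly.
From mathcomp Require Import boolp reals sequences exp.
From mathcomp Require Import ring lra zify.
Import Order.TTheory GRing.Theory Num.Theory.
Local Open Scope ring_scope.

(* Call a step odd if f(1) = 1.  An even step lowers the degree by one and an odd
   step keeps it, so after k steps (x+1)^k T^k(f) = x^s f + r, where s is the number
   of odd steps and deg r < k.  Two facts follow.

   - If f, g have degree n and T^k f = T^k g has degree d, then deg (f - g) < n - d.
     So among the 2^n polynomials of degree n, at most 2^(n-d) #B reach a given set B
     of polynomials of degree d at time k: no independence is needed.
   - If f, g share their first k parities then (x+1)^k divides f - g, so polynomials
     of degree d inject into the parity vectors of length d.  Comparing with the
     fixed point 1, this also yields tau(f) <= 2 deg(f)^2.

   By a Chernoff bound all but a proportion exp(-c d) of the polynomials of degree d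
   make about d/2 odd steps among their first d steps, and then have degree about d/2.
   A union bound over k < 2n^2 and over d >= c sqrt(n) shows that, with the required
   probability, the degree is halved this way until it drops below c sqrt(n), where
   the quadratic bound on tau leaves at most eps n / 2 further steps. *)

Implicit Types (k d n : nat) (f g : {poly 'F_2}).

(** * Parities and the degree along an orbit *)

Definition parity (f : {poly 'F_2}) : bool := f.[1] != 0.

Definition odd_steps (k : nat) (f : {poly 'F_2}) : nat :=
  \sum_(i < k) parity (iter i T f).

Lemma odd_stepsS k f :
  odd_steps k.+1 f = (odd_steps k f + parity (iter k T f))%N.
Proof. by rewrite /odd_steps big_ord_recr. Qed.

Lemma F2_neq0 (a : 'F_2) : a != 0 -> a = 1.
Proof. by case: a => [[|[|]]] // ? _; apply/val_inj. Qed.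

Lemma X1E : 'X + 1 = 'X - 1%:P :> {poly 'F_2}.
Proof. by rewrite -polyCN; congr (_ + _%:P); exact/val_inj. Qed.

(** Both divisions in [T] are exact, as the numerators vanish at 1; everything later uses only this
    product form. *)
Lemma mul_X1_T f :
  ('X + 1) * T f = if parity f then 'X * f + 1 else f.
Proof.
rewrite /T /parity mulrC; case: eqP => [f1|/eqP f1] /=;
  rewrite divpK // X1E dvdp_XsubCl rootE ?f1 //.
by rewrite !hornerE (F2_neq0 _ f1); apply/eqP/val_inj.
Qed.

Lemma T_neq0 f : f != 0 -> T f != 0.
Proof.
move=> f0; apply/eqP => Tf0; have := mul_X1_T f; rewrite Tf0 mulr0.
case: parity => [/esym /eqP|/esym/eqP]; last by rewrite (negPf f0).
rewrite -size_poly_eq0 mulrC size_polyDl size_mulX //.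
by rewrite size_poly1 ltnS lt0n size_poly_eq0.
Qed.

Lemma size_T f : f != 0 -> (size (T f)).+1 = (size f + parity f)%N.
Proof.
move=> f0.
have := congr1 (fun p : {poly 'F_2} => size p) (mul_X1_T f).
rewrite /= X1E size_monicM ?T_neq0 ?monicXsubC // size_XsubC addSn add1n /= => ->.
case: parity; rewrite ?addn0 // size_polyDl mulrC size_mulX ?addn1 //.
by rewrite size_poly1 ltnS lt0n size_poly_eq0.
Qed.

Lemma iter_T_neq0 k f : f != 0 -> iter k T f != 0.
Proof. by move=> f0; elim: k => //= k; exact: T_neq0. Qed.

Lemma size_iter_T k f : f != 0 ->
  (size (iter k T f) + k)%N = (size f + odd_steps k f)%N.
Proof.
move=> f0; elim: k => [|k IH]; first by rewrite /odd_steps big_ord0.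
by rewrite odd_stepsS addnA -IH iterS addnS -addSn size_T ?iter_T_neq0 // addnAC.
Qed.

(** * Expansion of the iterates, their fibres and parity vectors *)

Lemma iter_T_expansion k f : exists2 r : {poly 'F_2}, (size r <= k)%N &
  ('X + 1) ^+ k * iter k T f = 'X^(odd_steps k f) * f + r.
Proof.
elim: k => [|k [r szr IH]].
  by exists 0; rewrite ?size_poly0 // /odd_steps big_ord0 !mul1r addr0.
rewrite iterS exprSr -mulrA mul_X1_T odd_stepsS.
case: parity; last first.
  by exists r; rewrite ?addn0 // (leq_trans szr).
exists ('X * r + ('X + 1) ^+ k).
  rewrite (leq_trans (size_polyD _ _)) // geq_max X1E size_exp_XsubC leqnn andbT.
  by rewrite mulrC (leq_trans (size_polyMleq _ _)) // size_polyX addn2.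
by rewrite addn1 exprS mulrDr mulr1 mulrCA IH mulrDr !mulrA -addrA.
Qed.

(** Equal sizes at both ends force the same number s of odd steps. Subtracting the two expansions
    leaves x^s (f - g) of size at most k, and k - s is the loss of degree. *)
Lemma iter_T_fibre k f g : f != 0 -> size f = size g ->
  iter k T f = iter k T g ->
  (size (f - g)%R <= size f - size (iter k T f))%N.
Proof.
move=> f0 szfg eqT.
have g0 : g != 0 by rewrite -size_poly_eq0 -szfg size_poly_eq0.
have [r szr Er] := iter_T_expansion k f.
have [q szq Eq] := iter_T_expansion k g.
have Hf := size_iter_T k f f0.
have Hg := size_iter_T k g g0.
have E : odd_steps k f = odd_steps k g by rewrite -eqT -szfg in Hg; lia.
have [->|fg0] := eqVneq f g; first by rewrite subrr size_poly0.
have /(congr1 (fun p : {poly 'F_2} => size p)) :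
    (f - g) * 'X^(odd_steps k f) = q - r.
  have := Er; rewrite eqT Eq -E => H.
  by rewrite mulrC mulrBr; apply/eqP; rewrite subr_eq [eqbRHS]addrC addrA H addrK.
rewrite size_mulXn ?subr_eq0 // => H.
have : (size (q - r)%R <= k)%N.
  by rewrite (leq_trans (size_polyD _ _)) // geq_max size_polyN szr szq.
by rewrite -H; lia.
Qed.

(** With equal parities the terms +1 of the odd steps cancel, so the expansion has no remainder. *)
Lemma iter_T_sub k f g :
  (forall i, (i < k)%N -> parity (iter i T f) = parity (iter i T g)) ->
  ('X + 1) ^+ k * (iter k T f - iter k T g) = 'X^(odd_steps k f) * (f - g).
Proof.
elim: k => [|k IH] par_eq; first by rewrite /odd_steps big_ord0.
rewrite !iterS exprSr -mulrA mulrBr !mul_X1_T odd_stepsS -par_eq // exprD.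
rewrite mulrAC -IH; last by move=> i ik; apply: par_eq; lia.
case: parity; last by rewrite expr0 mulr1.
by rewrite expr1 opprD addrACA subrr addr0 -mulrBr mulrCA mulrC.
Qed.

Lemma parity_inj k f g : (size (f - g)%R <= k)%N ->
  (forall i, (i < k)%N -> parity (iter i T f) = parity (iter i T g)) -> f = g.
Proof.
move=> szfg /iter_T_sub E; apply/eqP; rewrite -subr_eq0; apply: contraLR szfg => fg0.
have : ('X + 1) ^+ k %| 'X^(odd_steps k f) * (f - g) by rewrite -E dvdp_mulr.
(* Since x + 1 and x are coprime, (x+1)^k divides f - g, which is too small unless it is 0. *)
rewrite Gauss_dvdpr; last first.
  rewrite coprimep_expl // coprimep_expr // X1E -[X in coprimep _ X]subr0.
  by rewrite -polyC0 coprimep_XsubC2 // sub0r oppr_eq0 oner_eq0.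
by move=> /dvdp_leq; rewrite subr_eq0 -subr_eq0 fg0 X1E size_exp_XsubC -ltnNge; apply.
Qed.

(** * The fixed point 1 and bounds on [tau] *)

Lemma iter_T1 k : iter k T 1 = 1.
Proof.
elim: k => //= k ->; have := mul_X1_T 1.
have -> : parity 1 by rewrite /parity hornerC.
by rewrite mulr1 -[RHS]mulr1; apply: mulfI; rewrite X1E polyXsubC_eq0.
Qed.

Lemma size1_eq1 (f : {poly 'F_2}) : size f = 1%N -> f = 1.
Proof. by move=> /eqP/size_poly1P[c c0 ->]; rewrite (F2_neq0 _ c0). Qed.

(* An orbit with the parities of the fixed point 1 must itself be 1. *)
Lemma even_step_ex f : (1 < size f)%N ->
  exists2 i, (i < size f)%N & ~~ parity (iter i T f).
Proof.
move=> szf; apply: contrapT => H.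
have : f = 1.
  apply: (parity_inj (size f)).
    by rewrite (leq_trans (size_polyD _ _)) // size_polyN size_poly1 geq_max leqnn ltnW.
  move=> i ilt; rewrite iter_T1 /parity hornerC oner_eq0 /=.
  by apply: contrapT => /negP h; apply: H; exists i.
by move=> f1; rewrite f1 size_poly1 in szf.
Qed.

Lemma size_iter_T_leq k f : f != 0 -> (size (iter k T f) <= size f)%N.
Proof.
move=> f0; elim: k => //= k IH; apply: leq_trans IH.
by have := size_T _ (iter_T_neq0 k f f0); case: parity => /=; lia.
Qed.

Lemma reaches_one d f : size f = d.+1 ->
  exists2 k, (k <= 2 * d ^ 2)%N & iter k T f = 1.
Proof.
elim/ltn_ind: d f => -[|d] IH f szf; first by exists 0%N => //; exact: size1_eq1.
have f0 : f != 0 by rewrite -size_poly_eq0 szf.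
have [|i ilt pari] := even_step_ex f; first by rewrite szf.
have := size_T _ (iter_T_neq0 i f f0).
rewrite (negPf pari) addn0 -iterS => szi.
have := size_iter_T_leq i f f0; rewrite szf => lei.
have Ti0 := iter_T_neq0 i.+1 f f0.
have [e sze] : exists e, size (iter i.+1 T f) = e.+1.
  by exists (size (iter i.+1 T f)).-1; rewrite prednK // lt0n size_poly_eq0.
have [|k kle Ek] := IH e _ _ sze; first by lia.
exists (k + i.+1)%N; last by rewrite iterD.
(* The degree is d + 1 here, with e <= d and i + 1 <= d + 2, and 2d^2 + d + 2 <= 2(d+1)^2. *)
by have := leq_sqr e d; rewrite szf in ilt; nia.
Qed.

Lemma tau_iter f : f != 0 -> iter (tau f) T f = 1.
Proof.
move=> f0; rewrite /tau; case: pselect => [H|[]].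
  by case: ex_minnP => m /eqP.
have szf : size f = (size f).-1.+1 by rewrite prednK // lt0n size_poly_eq0.
by have [k _ E] := reaches_one _ _ szf; exists k; rewrite E.
Qed.

Lemma tau_le f k : iter k T f = 1 -> (tau f <= k)%N.
Proof.
move=> E; rewrite /tau; case: pselect => [H|[]]; last by exists k; rewrite E.
by case: ex_minnP => m _; apply; rewrite E.
Qed.

Lemma tau_ub d f : size f = d.+1 -> (tau f <= 2 * d ^ 2)%N.
Proof. by case/reaches_one => k kle /tau_le; move/leq_trans; apply. Qed.

Lemma tau_lb d f : size f = d.+1 -> (d <= tau f)%N.
Proof.
move=> szf; have f0 : f != 0 by rewrite -size_poly_eq0 szf.
by have := size_iter_T (tau f) f f0; rewrite tau_iter // size_poly1 szf; lia.
Qed.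

(** By [tau_lb] the first d steps cannot overshoot the first visit to 1. *)
Lemma tauD d f : size f = d.+1 -> tau f = (d + tau (iter d T f))%N.
Proof.
move=> szf; have f0 : f != 0 by rewrite -size_poly_eq0 szf.
have dle := tau_lb _ _ szf.
apply/eqP; rewrite eqn_leq tau_le /=; last by rewrite addnC iterD tau_iter // iter_T_neq0.
by rewrite -leq_subRL // tau_le // -iterD subnK // tau_iter.
Qed.

(** * Counting polynomials by a value they visit *)

Lemma size_sub_monicF2 d f g : size f = d.+1 -> size g = d.+1 ->
  (size (f - g)%R <= d)%N.
Proof.
have lead1 (h : {poly 'F_2}) : size h = d.+1 -> h`_d = 1.
  move=> szh; apply: F2_neq0; have -> : h`_d = lead_coef h by rewrite lead_coefE szh.
  by rewrite lead_coef_eq0 -size_poly_eq0 szh.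
move=> szf szg; apply/leq_sizeP => j; rewrite leq_eqVlt coefB.
move=> /predU1P[<-|dj]; first by rewrite !lead1 // subrr.
by rewrite !nth_default ?subrr // ?szf ?szg.
Qed.

(** By [iter_T_fibre], p is determined by its n - d lowest coefficients and its k-th iterate. *)
Lemma card_visits (P : pred {poly 'F_2}) k n d :
  (#|[set p : {poly_n.+1 'F_2} | [&& size (val p) == n.+1,
        size (iter k T (val p)) == d.+1 & P (iter k T (val p))]]| <=
   2 ^ (n - d) *
     #|[set q : {poly_d.+1 'F_2} | (size (val q) == d.+1) && P (val q)]|)%N.
Proof.
set V := finset _; set B := finset _.
pose h (p : {poly_n.+1 'F_2}) :=
  (npolyp (n - d) (val p), npolyp d.+1 (iter k T (val p))).
have inj_h : {in V &, injective h}.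
  move=> p q; rewrite !inE => /and3P[/eqP szp /eqP szTp _] /and3P[/eqP szq /eqP szTq _].
  move=> [Elow ETk]; apply/val_inj.
  have p0 : val p != 0 by rewrite -size_poly_eq0 szp.
  have {}ETk : iter k T (val p) = iter k T (val q).
    have := congr1 (fun u : {poly_d.+1 'F_2} => val u) ETk.
    by rewrite /= !npolypK ?szTp ?szTq.
  have := iter_T_fibre k _ _ p0 (etrans szp (esym szq)) ETk.
  rewrite szp szTp subSS => szpq; apply/polyP => i.
  have [ilt|ige] := ltnP i (n - d).
    have := congr1 (fun u : {poly_(n - d) 'F_2} => (val u)`_i) Elow.
    by rewrite /= !coef_npolyp ilt.
  by apply/eqP; rewrite -subr_eq0 -coefB nth_default // (leq_trans szpq).
rewrite -(card_in_imset inj_h).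
have <- : #|[set: {poly_(n - d) 'F_2}]| = (2 ^ (n - d))%N.
  by rewrite cardsT card_npoly card_Fp.
rewrite -cardsX; apply/subset_leq_card/subsetP => _ /imsetP[p + ->].
rewrite !inE /= => /and3P[_ /eqP szT PT].
by rewrite npolypK ?szT // eqxx.
Qed.

(** * Chernoff bound for the number of odd steps *)

Section Chernoff.
Variable R : realType.
Implicit Types a x delta : R.

Lemma expR_le_quadratic x : `|x| <= 1 / 2 -> expR x <= 1 + x + 2 * x ^+ 2.
Proof.
rewrite ler_norml => /andP[lx ux].
have x1 : 0 < 1 - x by lra.
(* It remains to see that (1 - x)(1 + x + 2x^2) = 1 + x^2 (1 - 2x) >= 1. *)
have H : (1 - x) * expR x <= 1.
  rewrite -[leRHS](expRxMexpNx_1 x) mulrC ler_pM2l ?expR_gt0 //.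
  by have := expR_ge1Dx (- x).
rewrite -(ler_pM2l x1) (le_trans H) //.
by have := sqr_ge0 x; nra.
Qed.

Lemma expRD_expRN_le a : 0 <= a <= 1 / 2 ->
  expR a + expR (- a) <= 2 * expR (2 * a ^+ 2).
Proof.
move=> /andP[a0 a1].
have := expR_le_quadratic a; have := expR_le_quadratic (- a).
rewrite normrN ger0_norm // sqrrN => /(_ a1) h1 /(_ a1) h2.
by have := expR_ge1Dx (2 * a ^+ 2); lra.
Qed.

Definition ones d (v : {ffun 'I_d -> bool}) : nat := \sum_i v i.

(** Up to the factor 2^d, this is the moment generating function of a sum of d independent signs, so
    it factorises. *)
Lemma sum_expR_ones a d :
  \sum_(v : {ffun 'I_d -> bool}) expR (a * (2 * (ones d v)%:R - d%:R)) =
  (expR a + expR (- a)) ^+ d.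
Proof.
transitivity (\prod_(i < d) \sum_(b : bool) expR (a * (2 * b%:R - 1))); last first.
  rewrite prodr_const card_ord big_bool /=; congr ((expR _ + expR _) ^+ _); ring.
rewrite bigA_distr_bigA /=; apply: eq_bigr => v _.
rewrite -expR_sum -mulr_sumr sumrB -mulr_sumr /ones natr_sum sumr_const card_ord.
by [].
Qed.

Lemma card_ones_deviation delta d : 0 <= delta <= 1 ->
  #|[set v : {ffun 'I_d -> bool} |
      2 * delta * d%:R < `|2 * (ones d v)%:R - d%:R|]|%:R <=
  2 * 2 ^+ d * expR (- (delta ^+ 2 / 2 * d%:R)).
Proof.
move=> /andP[de0 de1]; set D := finset _.
(* This value minimises the exponent 2 a^2 d - 2 a delta d of the Markov bound. *)
pose a := delta / 2.
have a0 : 0 <= a by rewrite /a; lra.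
pose X (v : {ffun 'I_d -> bool}) : R := 2 * (ones d v)%:R - d%:R.
have markov : #|D|%:R * expR (delta ^+ 2 * d%:R) <= 2 * (expR a + expR (- a)) ^+ d.
  (* The two exponentials handle deviations of either sign. *)
  have -> : 2 * (expR a + expR (- a)) ^+ d =
      \sum_(v : {ffun 'I_d -> bool}) (expR (a * X v) + expR (- a * X v)).
    rewrite big_split /= !sum_expR_ones opprK [expR (- a) + _]addrC.
    by rewrite mulr_natl mulr2n.
  rewrite mulr_natl -sumr_const [leLHS]big_mkcond; apply: ler_sum => v _ /=.
  case: ifPn => [|_]; last by rewrite addr_ge0 ?expR_ge0.
  rewrite inE -/(X v) => dev.
  have [X0|X0] := leP 0 (X v).
    rewrite ler_wpDr ?expR_ge0 // ler_expR; rewrite ger0_norm // in dev.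
    by rewrite /a; nra.
  rewrite ler_wpDl ?expR_ge0 // ler_expR; rewrite ltr0_norm // in dev.
  by rewrite /a; nra.
have ub : (expR a + expR (- a)) ^+ d <= 2 ^+ d * expR (delta ^+ 2 / 2 * d%:R).
  have -> : delta ^+ 2 / 2 = 2 * a ^+ 2 by rewrite /a; field.
  rewrite expRM_natr -exprMn lerXn2r ?nnegrE ?addr_ge0 ?mulr_ge0 ?expR_ge0 //.
  by apply: expRD_expRN_le; rewrite a0 /a; lra.
rewrite -(ler_pM2r (expR_gt0 (delta ^+ 2 * d%:R))) (le_trans markov) //.
rewrite -[leRHS]mulrA -expRD -[leRHS]mulrA ler_pM2l // (le_trans ub) //.
by rewrite ler_pM2l ?exprn_gt0 // ler_expR; lra.
Qed.

(** Meant for f of degree d: the number of odd steps, which is then the degree after d steps, is off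
    d/2 by more than delta d. *)
Definition atypical delta d f : bool :=
  2 * delta * d%:R < `|2 * (odd_steps d f)%:R - d%:R|.

(** By [parity_inj], taking the first d parities is injective in degree d, so the count for bit
    vectors applies. *)
Lemma card_atypical delta d : 0 <= delta <= 1 ->
  #|[set p : {poly_d.+1 'F_2} |
      (size (val p) == d.+1) && atypical delta d (val p)]|%:R <=
  2 * 2 ^+ d * expR (- (delta ^+ 2 / 2 * d%:R)) :> R.
Proof.
move=> /(card_ones_deviation _ d); apply: le_trans; rewrite ler_nat.
set A := finset _; set B := finset _.
pose h (p : {poly_d.+1 'F_2}) := [ffun i : 'I_d => parity (iter i T (val p))].
have inj_h : {in A &, injective h}.
  move=> p q; rewrite !inE => /andP[/eqP szp _] /andP[/eqP szq _] Eh.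
  apply/val_inj/(parity_inj d); first exact: size_sub_monicF2.
  by move=> i ilt; have /ffunP/(_ (Ordinal ilt)) := Eh; rewrite !ffunE.
rewrite -(card_in_imset inj_h).
apply/subset_leq_card/subsetP => _ /imsetP[p + ->].
rewrite !inE /atypical => /andP[_].
have -> // : ones d (h p) = odd_steps d (val p).
by apply: eq_bigr => i _; rewrite ffunE.
Qed.

End Chernoff.

(** * Halving of the degree along a typical orbit *)

Lemma iter_T_ge_tau k f : f != 0 -> (tau f <= k)%N -> iter k T f = 1.
Proof. by move=> f0 tk; rewrite -(subnK tk) iterD tau_iter // iter_T1. Qed.

Lemma sqrt_natr_le (R : realType) n : (0 < n)%N ->
  Num.sqrt n%:R <= n%:R :> R.
Proof.
move=> n0; rewrite -{2}(sqr_sqrtr (ler0n R n)) expr2 ler_peMl ?sqrtr_ge0 //.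
by rewrite -[leLHS]sqrtr1 ler_wsqrtr // ler1n.
Qed.

(* Running T for d steps from degree d leaves a polynomial whose degree is
   exactly the number of odd steps, hence about d / 2 when the start is typical;
   the geometric sum of these halvings gives 2 d. *)
Lemma tau_typical (R : realType) (eps : R) n f : 0 < eps <= 1 ->
  size f = n.+1 ->
  (forall k d, (k < 2 * n ^ 2)%N -> size (iter k T f) = d.+1 ->
     eps / 4 * Num.sqrt n%:R <= d%:R ->
     ~~ atypical R (eps / 16) d (iter k T f)) ->
  `|(tau f)%:R - 2 * n%:R| <= eps * n%:R.
Proof.
move=> /andP[e0 e1] szf typ.
have f0 : f != 0 by rewrite -size_poly_eq0 szf.
(* The error splits into a part proportional to d, renewed at each halving, and a part in n, spent
   once when the halving stops. *)
suff H d k : size (iter k T f) = d.+1 ->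
    `|(tau (iter k T f))%:R - 2 * d%:R| <= eps / 2 * d%:R + eps / 2 * n%:R.
  by have := H n 0%N szf; rewrite /=; lra.
elim/ltn_ind: d k => d IH k szg; set g := iter k T f in szg *.
have lb := tau_lb _ _ szg; have ub := tau_ub _ _ szg.
have [d0|d_gt0] := posnP d.
  have -> : tau g = 0%N by move: ub; rewrite d0; lia.
  by rewrite d0 mulr0 subr0 normr0 mulr0 add0r; have := ler0n R n; nra.
have dn : (d <= n)%N by have := size_iter_T_leq k f f0; rewrite -/g szg szf.
(* For small d, tau <= 2d^2 <= eps^2 n / 8, while 2d - tau <= d <= eps n / 4. *)
have [small|big] := ltP (d%:R : R) (eps / 4 * Num.sqrt n%:R).
  have lbR : d%:R <= (tau g)%:R :> R by rewrite ler_nat.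
  have ubR : (tau g)%:R <= 2 * d%:R ^+ 2 :> R by rewrite -natrX -natrM ler_nat.
  have sn := sqr_sqrtr (ler0n R n).
  have sle := sqrt_natr_le R n (leq_trans d_gt0 dn).
  have s0 := sqrtr_ge0 (n%:R : R).
  have d0 := ler0n R d; have n0 := ler0n R n.
  set s := Num.sqrt _ in small sn sle s0.
  set t : R := (tau g)%:R in lbR ubR *.
  set x : R := d%:R in small lbR ubR d0 *.
  set y : R := n%:R in sn sle n0 *.
  have x2 : x ^+ 2 <= (eps / 4 * s) ^+ 2.
    by rewrite lerXn2r ?nnegrE ?(ltW small) ?(le_trans d0 (ltW small)).
  have e2 : eps ^+ 2 * y <= eps * y by rewrite ler_wpM2r // expr2 ler_piMl // ltW.
  have es : eps * s <= eps * y by rewrite ler_wpM2l // ltW.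
  have ex : 0 <= eps * x by rewrite mulr_ge0 // ltW.
  have ey : 0 <= eps * y by rewrite mulr_ge0 // ltW.
  rewrite exprMn sn in x2.
  rewrite ler_norml; apply/andP; split; nra.
(* As d > 0, the orbit has not reached 1 at time k, so k < tau f. *)
have kub : (k < 2 * n ^ 2)%N.
  rewrite (leq_trans _ (tau_ub _ _ szf)) // ltnNge; apply/negP => tk.
  by move: szg; rewrite /g iter_T_ge_tau // size_poly1; lia.
have := typ k d kub szg big; rewrite /atypical -leNgt.
set o := odd_steps d _ => dev.
have g0 : g != 0 by rewrite iter_T_neq0.
have szo : size (iter (d + k) T f) = o.+1.
  by have := size_iter_T d g g0; rewrite szg iterD -/g -/o; lia.
move: dev; rewrite ler_norml => /andP[dev1 dev2].
have d0 : 0 < d%:R :> R by rewrite ltr0n.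
have od : (o < d)%N.
  rewrite -(ltr_nat R).
  have : eps * d%:R <= d%:R by rewrite ler_piMl // ltW.
  lra.
have := IH o od (d + k)%N szo; rewrite iterD -/g (tauD _ _ szg) natrD.
rewrite !ler_norml => /andP[h1 h2].
(* The error in d is at most |2o - d| + eps o / 2 <= (1/8 + 1/4 + eps/32) eps d <= eps d / 2. *)
have ed : eps * (eps * d%:R) <= eps * d%:R by rewrite ler_piMl ?mulr_ge0 // ltW.
have eo : eps * o%:R <= eps * ((1 / 2 + eps / 16) * d%:R).
  by rewrite ler_wpM2l ?(ltW e0) //; lra.
apply/andP; split; lra.
Qed.

(** * Union bound over the atypical visits *)

Lemma cube_le_expR_sqrt (R : realType) (D : R) : 0 < D ->
  exists2 C : R, 0 < C & forall n,
    4 * n%:R ^+ 2 * (n%:R + 1) <= C * expR (D * Num.sqrt n%:R).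
Proof.
(* With s = sqrt n the left side is 4 s^6 + 4 s^4, and s^m <= m! / D^m e^(Ds) for m = 6 and m =
   4. *)
move=> D0; exists (4 * (720 / D ^+ 6 + 24 / D ^+ 4)).
  by rewrite mulr_gt0 // addr_gt0 // divr_gt0 // exprn_gt0.
move=> n; have s0 := sqrtr_ge0 (n%:R : R).
rewrite -{1 2}(sqr_sqrtr (ler0n R n)).
set s := Num.sqrt _ in s0 *; set E := expR _.
have Ds0 : 0 <= D * s by rewrite mulr_ge0 // ltW.
have power m : s ^+ m.+1 <= (m.+1)`!%:R / D ^+ m.+1 * E.
  rewrite mulrAC ler_pdivlMr ?exprn_gt0 // mulrC -exprMn -ler_pdivrMl ?ltr0n ?fact_gt0 //.
  by have := expR_ge1Dxn m Ds0; rewrite -/E mulrC; lra.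
have := power 5; have := power 3.
rewrite -[(3.+1)`!]/24%N -[(5.+1)`!]/720%N => h4 h6.
by lra.
Qed.

Lemma card_bigcup_leq (I U : finType) (P : pred I) (F : I -> {set U}) :
  (#|\bigcup_(i | P i) F i| <= \sum_(i | P i) #|F i|)%N.
Proof.
elim/big_rec2: _ => [|i m A _ IH]; first by rewrite cards0.
by rewrite (leq_trans (leq_card_setU _ _).1) // leq_add2l.
Qed.

Lemma card_monicF2 n :
  (2 ^ n <= #|[set p : {poly_n.+1 'F_2} | size (val p) == n.+1]|)%N.
Proof.
pose h (p : {poly_n 'F_2}) := npolyp n.+1 ('X^n + val p).
have szh (p : {poly_n 'F_2}) : size ('X^n + val p) = n.+1.
  by rewrite size_polyDl size_polyXn // ltnS size_npoly.
have inj_h : injective h.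
  move=> p q /(congr1 (fun u : {poly_n.+1 'F_2} => val u)).
  by rewrite /= !npolypK ?szh // => /addrI /val_inj.
rewrite -[X in (X ^ n)%N](card_Fp (isT : prime 2)) -card_npoly -cardsT.
rewrite -(card_imset _ inj_h).
apply/subset_leq_card/subsetP => _ /imsetP[p _ ->].
by rewrite inE /= npolypK ?szh.
Qed.

Theorem theorem2p15 (R : realType) (eps : R) (heps : 0 < eps) :
  exists C D : R, 0 < C /\ 0 < D /\
    forall n : nat,
      (count_good eps n)%:R / 2%:R ^+ n >= 1 - C * expR (- (D * Num.sqrt n%:R)).
Proof.
(* [tau_typical] asks for a tolerance at most 1; shrinking it only narrows the window. *)
pose e := Num.min eps 1.
have e0 : 0 < e by rewrite lt_min heps ltr01.
have e1 : e <= 1 by rewrite ge_min lexx orbT.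
have e_eps : e <= eps by rewrite ge_min lexx.
pose c := e / 4; pose delta := e / 16.
(* Half of the Chernoff exponent at d = c sqrt n: the other half absorbs the number of pairs (k,
   d). *)
pose D := delta ^+ 2 / 2 * c / 2.
have D0 : 0 < D.
  by rewrite divr_gt0 // mulr_gt0 ?divr_gt0 // exprn_gt0 // divr_gt0.
have [C C0 HC] := cube_le_expR_sqrt R D D0.
exists C, D; do 2!split=> //; move=> n.
set s := Num.sqrt _.
pose V k d := [set p : {poly_n.+1 'F_2} | [&& size (val p) == n.+1,
  size (iter k T (val p)) == d.+1 & atypical R delta d (iter k T (val p))]].
pose Bad := \bigcup_(kd : 'I_(2 * n ^ 2) * 'I_n.+1 | c * s <= kd.2%:R)
  V kd.1 kd.2.
have cover : (2 ^ n <= count_good eps n + #|Bad|)%N.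
  rewrite (leq_trans (card_monicF2 n)) // (leq_trans _ (leq_card_setU _ _).1) //.
  apply/subset_leq_card/subsetP => p; rewrite !inE => szp; rewrite szp /=.
  rewrite orbC -implyNb; apply/implyP => notbad.
  suff : `|(tau (val p))%:R - 2 * n%:R| <= e * n%:R :> R.
    rewrite ler_norml => /andP[h1 h2].
    have : e * n%:R <= eps * n%:R by rewrite ler_wpM2r.
    by move=> h; apply/andP; split; lra.
  apply: tau_typical; [by rewrite e0 | exact/eqP |].
  move=> k d klt szk big; apply: contra notbad => atyp.
  have p0 : val p != 0 by rewrite -size_poly_eq0 (eqP szp).
  have dlt : (d < n.+1)%N.
    by have := size_iter_T_leq k _ p0; rewrite szk (eqP szp).
  apply/bigcupP; exists (Ordinal klt, Ordinal dlt) => //.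
  by rewrite inE szp szk eqxx.
have card_V k d : (d <= n)%N -> c * s <= d%:R ->
    #|V k d|%:R <= 2 * 2 ^+ n * expR (- (2 * D * s)).
  move=> dn big.
  have := card_visits (atypical R delta d) k n d.
  rewrite -(ler_nat R) => /le_trans; apply; rewrite natrM natrX.
  have de01 : 0 <= delta <= 1 by rewrite /delta; lra.
  apply: (@le_trans _ _ (2 ^+ (n - d) *
      (2 * 2 ^+ d * expR (- (delta ^+ 2 / 2 * d%:R))))).
    by rewrite ler_wpM2l ?exprn_ge0 // card_atypical.
  (* The powers 2^(n-d) and 2^d recombine to 2^n, so the proportion is bounded as in degree d,
     uniformly in k. *)
  rewrite mulrA [_ ^+ _ * (2 * _)]mulrCA -exprD subnK //.
  rewrite ler_wpM2l ?mulr_ge0 ?exprn_ge0 // ler_expR lerN2.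
  have -> : 2 * D * s = delta ^+ 2 / 2 * (c * s) by rewrite /D; field.
  by rewrite ler_wpM2l // divr_ge0 // sqr_ge0.
have card_Bad : #|Bad|%:R <= 2 ^+ n * (C * expR (- (D * s))).
  apply: (@le_trans _ _ (\sum_(kd : 'I_(2 * n ^ 2) * 'I_n.+1)
      2 * 2 ^+ n * expR (- (2 * D * s)))).
    apply: (@le_trans _ _ (\sum_(kd : 'I_(2 * n ^ 2) * 'I_n.+1 |
        c * s <= kd.2%:R) #|V kd.1 kd.2|)%:R).
      by rewrite ler_nat card_bigcup_leq.
    rewrite natr_sum big_mkcond /=; apply: ler_sum => -[k d] _ /=.
    case: ifP => [big|_]; first by rewrite card_V // -ltnS.
    by rewrite !mulr_ge0 ?exprn_ge0 ?expR_ge0.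
  rewrite sumr_const card_prod !card_ord -[leLHS]mulr_natr !natrM.
  rewrite -[n.+1%:R]natr1.
  (* One factor e^(-Ds) cancels 4 n^2 (n+1) up to C; the other remains. *)
  have -> : - (2 * D * s) = - (D * s) + - (D * s) by ring.
  have Hn := HC n; rewrite expRD expRN -/s in Hn *.
  set E := expR _ in Hn *; have E0 : 0 < E := expR_gt0 _.
  rewrite -(ler_pdivrMr _ _ E0) in Hn.
  have P0 : 0 <= 2 ^+ n * E^-1 :> R by rewrite mulr_ge0 ?exprn_ge0 ?invr_ge0 ?ltW.
  have := ler_wpM2l P0 Hn.
  by congr (_ <= _); ring.
have p2 : 0 < 2 ^+ n :> R by rewrite exprn_gt0.
rewrite ler_pdivlMr //.
move: cover; rewrite -(ler_nat R) natrX natrD => cover.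
lra.
Qed.
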